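(* For every $n\ge 1$, the depth triangles of order $n$ are in bijection with the catalan triangles of order $n$.
   Context: $\mathcal{D}_n$ is the set of triples $(y_1,y_2,y_3)\in\mathbb{N}^3$ with $y_1+y_2+y_3=n-2$. A depth triangle of order $n$ is a map $\delta:\mathcal{D}_n\to\mathbb{Z}$ such that $\delta(i,0,n-2-i)=0$ for all $0\le i\le n-2$, and $|\delta(y_1,y_2,y_3)-\delta(y_1,y_2-1,y_3+1)|=1=|\delta(y_1,y_2,y_3)-\delta(y_1+1,y_2-1,y_3)|$ for all $(y_1,y_2,y_3)\in\mathcal{D}_n$ with $y_2\ge1$. A catalan triangle of order $n$ is a doubly gapless Gelfand--Tsetlin pattern with bottom row $1\,2\cdots(n-1)$, i.e. a map $\gamma:\mathcal{D}_n\to\mathbb{N}$ such that $\gamma(i,0,n-2-i)=i+1$ for all $0\le i\le n-2$ and, for all $(y_1,y_2,y_3)\in\mathcal{D}_n$ with $y_2\ge1$, $\gamma(y_1,y_2-1,y_3+1)\le\gamma(y_1,y_2,y_3)\le\gamma(y_1+1,y_2-1,y_3)$, $\ \gamma(y_1,y_2,y_3)-\gamma(y_1,y_2-1,y_3+1)\le1$ and $\gamma(y_1+1,y_2-1,y_3)-\gamma(y_1,y_2,y_3)\le1$. *)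

(* Defs.v *)
From mathcomp Require Import all_boot all_order all_algebra.
From mathcomp Require Import boolp classical_sets functions.

Set Implicit Arguments.
Unset Strict Implicit.
Unset Printing Implicit Defensive.

Import Order.TTheory GRing.Theory Num.Theory.

Local Open Scope ring_scope.

(* The constraint is written without subtraction, so that [D 0] and [D 1] are
   empty, as they are when n - 2 is computed in the integers. *)
Definition D (n : nat) : Type :=
  {y : nat * nat * nat | (y.1.1 + y.1.2 + y.2 + 2 == n)%N}.

(* The condition val y = (i, 0, k) on a point y : D n forces k = n - 2 - i. In
   the steps, y = (y1, y2 + 1, y3) ranges over the points whose second
   coordinate is at least 1, and its two neighbours z and w, which always lie in
   D n, are specified by their coordinates. *)
Definition depth_triangle (n : nat) : set (D n -> int) :=
  [set delta : D n -> int |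
    (forall (i k : nat) (y : D n), val y = (i, 0%N, k) -> delta y = 0) /\
    (forall (y1 y2 y3 : nat) (y z w : D n),
       val y = (y1, y2.+1, y3) ->
       val z = (y1, y2, y3.+1) ->
       val w = (y1.+1, y2, y3) ->
       `|delta y - delta z| = 1 /\ `|delta y - delta w| = 1)].

Definition catalan_triangle (n : nat) : set (D n -> nat) :=
  [set gamma : D n -> nat |
    (forall (i k : nat) (y : D n), val y = (i, 0%N, k) -> gamma y = i.+1) /\
    (forall (y1 y2 y3 : nat) (y z w : D n),
       val y = (y1, y2.+1, y3) ->
       val z = (y1, y2, y3.+1) ->
       val w = (y1.+1, y2, y3) ->
       [/\ (gamma z <= gamma y <= gamma w)%N,
           (gamma y)%:Z - (gamma z)%:Z <= 1 &
           (gamma w)%:Z - (gamma y)%:Z <= 1])].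

Arguments depth_triangle n : clear implicits.
Arguments catalan_triangle n : clear implicits.

(* Main.v *)
(** The bijection is [gamma y = y1 + 1 + (delta y + y2) / 2], with inverse
    [delta y = 2 (gamma y - y1 - 1) - y2]: the two unit steps [+1, -1] of a
    depth triangle become the steps [1, 0] of a catalan triangle. The division
    is exact because [delta] changes parity whenever [y2] decreases by one, and
    its result is nonnegative because [|delta y| <= y2]. *)

Require Import Defs.
From mathcomp Require Import all_boot all_order all_algebra.
From mathcomp Require Import boolp classical_sets functions.
From mathcomp Require Import zify.

Import GRing.Theory.

(** On a depth triangle the integer inside is positive, so the absolute value merely casts it to
    [nat]. *)
Definition catalan_of_depth (n : nat) (delta : D n -> int) (y : D n) : nat :=
  `|((val y).1.1.+1%:Z + (divz (delta y + (val y).1.2%:Z) 2))%R|%N.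

Definition depth_of_catalan (n : nat) (gamma : D n -> nat) (y : D n) : int :=
  (((gamma y)%:Z - (val y).1.1.+1%:Z) * 2 - (val y).1.2%:Z)%R.

Lemma depth_neighbours (n y1 y2 y3 : nat) (y : D n) :
  val y = (y1, y2.+1, y3) ->
  exists z w : D n, val z = (y1, y2, y3.+1) /\ val w = (y1.+1, y2, y3).
Proof.
move=> vy; have := valP y; rewrite vy /= => hy.
pose P (u : nat * nat * nat) := u.1.1 + u.1.2 + u.2 + 2 == n.
have hz : P (y1, y2, y3.+1) by move: hy; rewrite /P /=; lia.
have hw : P (y1.+1, y2, y3) by move: hy; rewrite /P /=; lia.
by exists (exist P _ hz), (exist P _ hw).
Qed.

(** The witness [k] counts the up steps on the path of [z]-neighbours from the base to [y]: an up
    step raises [delta y + y2] by 2, a down step leaves it unchanged. *)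
Lemma depth_triangle_even_nonneg (n : nat) (delta : D n -> int) (y : D n) :
  depth_triangle n delta ->
  exists k : nat, (delta y + (val y).1.2%:Z = k%:Z * 2)%R.
Proof.
move=> [delta0 deltaS].
case vy: (val y) => [[y1 y2] y3] /=.
elim: y2 y1 y3 y vy => [|y2 IH] y1 y3 y vy.
  by exists 0; rewrite (delta0 _ _ _ vy).
have [z [w [vz vw]]] := depth_neighbours _ _ _ _ _ vy.
have [k hk] := IH _ _ _ vz.
have [dz _] := deltaS _ _ _ _ _ _ vy vz vw.
have [e|e] : (delta y = delta z + 1 \/ delta y = delta z - 1)%R by lia.
  by exists k.+1; lia.
by exists k; lia.
Qed.

(** Doubling clears both the division and the absolute value, which leaves only linear
    arithmetic. *)
Lemma catalan_of_depthE (n : nat) (delta : D n -> int) (y : D n) :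
  depth_triangle n delta ->
  ((catalan_of_depth n delta y)%:Z * 2 =
   (val y).1.1.+1%:Z * 2 + delta y + (val y).1.2%:Z)%R.
Proof.
move=> hd; have [k hk] := depth_triangle_even_nonneg n delta y hd.
by rewrite /catalan_of_depth hk mulzK //; lia.
Qed.

Lemma catalan_of_depth_fun (n : nat) (delta : D n -> int) :
  depth_triangle n delta -> catalan_triangle n (catalan_of_depth n delta).
Proof.
move=> hd; have E y := catalan_of_depthE n delta y hd.
case: (hd) => delta0 deltaS; split=> [i k y vy|y1 y2 y3 y z w vy vz vw].
  by have := E y; rewrite (delta0 _ _ _ vy) vy /=; lia.
have [dz dw] := deltaS _ _ _ _ _ _ vy vz vw.
have := E y; have := E z; have := E w; rewrite vy vz vw /= => Ew Ez Ey.
(* With [gamma] the image of [delta], [2 (gamma y - gamma z) = delta y - delta z + 1] and [2 (gamma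
   w - gamma y) = delta w - delta y + 1], both in {0, 2}. *)
by split; lia.
Qed.

Lemma depth_of_catalan_fun (n : nat) (gamma : D n -> nat) :
  catalan_triangle n gamma -> depth_triangle n (depth_of_catalan n gamma).
Proof.
move=> [gamma0 gammaS]; split=> [i k y vy|y1 y2 y3 y z w vy vz vw].
  by rewrite /depth_of_catalan (gamma0 _ _ _ vy) vy /=; lia.
have [] := gammaS _ _ _ _ _ _ vy vz vw.
rewrite /depth_of_catalan vy vz vw /= => h1 h2 h3.
by split; lia.
Qed.

(** Adding [y2] back leaves an explicit multiple of 2, so the division is exact for every
    [gamma]. *)
Lemma depth_of_catalanK (n : nat) :
  cancel (depth_of_catalan n) (catalan_of_depth n).
Proof.
move=> gamma; apply/funext => y.
rewrite /catalan_of_depth /depth_of_catalan subrK mulzK //; lia.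
Qed.

Theorem proposition4p14 (n : nat) (hn : (1 <= n)%N) :
  exists f : (D n -> int) -> (D n -> nat),
    set_bij (depth_triangle n) (catalan_triangle n) f.
Proof.
exists (catalan_of_depth n); split.
- exact: catalan_of_depth_fun.
- move=> d1 d2 /set_mem h1 /set_mem h2 e; apply/funext => y.
  (* Injectivity: the doubled identity recovers [delta y] from its image. *)
  have := catalan_of_depthE n d1 y h1; have := catalan_of_depthE n d2 y h2.
  by rewrite e; lia.
- move=> gamma hg; exists (depth_of_catalan n gamma).
    exact: depth_of_catalan_fun.
  exact: depth_of_catalanK.
Qed.
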